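(* Let $m$, $n$ and $q$ be positive integers. Then \[ \sum_{k = 1}^\infty \frac{(-1)^{nk-1}F_{2nk+mnq}\prod_{j=1}^{m-1}L_{nk+jnq}^2}{\prod_{j=0}^{m} F_{nk+jnq}^2} = \frac{5^m q}{4F_{mnq}} - \frac{1}{4F_{mnq}}\sum_{k=1}^{q}\prod_{j=0}^{m-1}\frac{L_{nk+jnq}^2}{F_{nk+jnq}^2}. \]
   Context: The Fibonacci numbers are defined by $F_0=0$, $F_1=1$, $F_n=F_{n-1}+F_{n-2}$, and the Lucas numbers by $L_0=2$, $L_1=1$, $L_n=L_{n-1}+L_{n-2}$. Infinite sums are limits of partial sums. Empty products equal $1$ (in particular $\prod_{j=1}^{0}=1$). *)

(* Defs.v *)
From mathcomp Require Import all_boot.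

Set Implicit Arguments.
Unset Strict Implicit.
Unset Printing Implicit Defensive.

Fixpoint fib (n : nat) : nat :=
  match n with
  | 0 => 0
  | S n' => match n' with
            | 0 => 1
            | S n'' => fib n' + fib n''
            end
  end.

Fixpoint lucas (n : nat) : nat :=
  match n with
  | 0 => 2
  | S n' => match n' with
            | 0 => 1
            | S n'' => lucas n' + lucas n''
            end
  end.

(* Main.v *)
Require Import Defs.
From mathcomp Require Import all_boot all_order all_algebra.
From mathcomp Require Import all_classical all_reals all_analysis.
From mathcomp Require Import ring zify.
Import Order.TTheory GRing.Theory Num.Theory.
Import numFieldNormedType.Exports.

(** With [a = nk] and [b = mnq], the numerator factors through
    [L_a^2 F_(a+b)^2 - F_a^2 L_(a+b)^2 = 4 (-1)^a F_b F_(2a+b)], so the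
    [k]-th term equals [(G (k + q) - G k) / (4 F_b)], where [G k] is the product
    of [L^2 / F^2] over the indices [nk + jnq], [j < m].  The series telescopes
    with lag [q], and [G k] tends to [5^m] because [L^2 = 5 F^2 + 4 (-1)^i]. *)

Local Open Scope classical_set_scope.
Local Open Scope ring_scope.

Arguments fib : simpl never.
Arguments lucas : simpl never.

Lemma fibSS n : fib n.+2 = (fib n.+1 + fib n)%N.
Proof. by []. Qed.

Lemma lucasSS n : lucas n.+2 = (lucas n.+1 + lucas n)%N.
Proof. by []. Qed.

Lemma two_step_ind (P : nat -> Prop) :
  P 0%N -> P 1%N -> (forall n, P n -> P n.+1 -> P n.+2) -> forall n, P n.
Proof.
move=> P0 P1 PSS n; suff [] : P n /\ P n.+1 by [].
by elim: n => [//|n [Pn PSn]]; split=> //; apply: PSS.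
Qed.

Lemma lucasD_fib n : (lucas n + fib n = 2 * fib n.+1)%N.
Proof.
by elim/two_step_ind: n => [//|//|n]; rewrite !fibSS !lucasSS; lia.
Qed.

Lemma lucasD_5fib n : (lucas n + 5 * fib n = 2 * lucas n.+1)%N.
Proof.
by elim/two_step_ind: n => [//|//|n]; rewrite !fibSS !lucasSS; lia.
Qed.

(** For fixed [b] both sides obey the Fibonacci recurrence in [a], so [a = 0] and [a = 1] decide;
    the latter is [lucasD_fib]. *)
Lemma fib_lucasD a b : (fib a * lucas b + fib b * lucas a = 2 * fib (a + b))%N.
Proof.
elim/two_step_ind: a => [||a IHa IHSa].
- by rewrite add0n mul0n add0n mulnC.
- by rewrite mul1n muln1 add1n lucasD_fib.
- by rewrite !addSn !fibSS lucasSS mulnDl !mulnDr -IHa -addSn -IHSa addnACA.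
Qed.

Lemma fib_gt0 n : (0 < n)%N -> (0 < fib n)%N.
Proof.
by case: n => // n _; elim: n => // n IHn; rewrite fibSS ltn_addr.
Qed.

Lemma fib_ge_pred n : (n <= fib n.+1)%N.
Proof.
elim: n => // -[//|n] IHn.
by rewrite fibSS -[leqLHS]addn1; apply: leq_add => //; exact: fib_gt0.
Qed.

(** Both sides obey the Fibonacci recurrence in [b] and vanish at [b = 0]. At [b = 1] the left side
    is a Casoratian-type determinant, which changes sign when [a] grows by one. *)
Lemma fib_lucasB (R : comPzRingType) a b :
  (fib (a + b))%:R * (lucas a)%:R - (fib a)%:R * (lucas (a + b))%:R
    = 2 * (-1) ^+ a * (fib b)%:R :> R.
Proof.
elim/two_step_ind: b => [||b IHb IHSb].
- by rewrite addn0 mulr0 subrr.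
- rewrite addn1 mulr1; elim: a => [|a IHa].
    by rewrite mul1r mul0r subr0 expr0 mulr1.
  rewrite fibSS lucasSS !natrD exprS mulN1r mulrN -IHa; ring.
- rewrite !addnS !fibSS lucasSS !natrD [RHS]mulrDr -IHb -IHSb !addnS; ring.
Qed.

(** Take [fib_lucasB] at [b = 1], double it, and replace [2 F_(n+1)] by [L_n + F_n] and [2 L_(n+1)]
    by [L_n + 5 F_n]. *)
Lemma lucas_sqr (R : comPzRingType) n :
  (lucas n)%:R ^+ 2 = 5 * (fib n)%:R ^+ 2 + 4 * (-1) ^+ n :> R.
Proof.
have := fib_lucasB R n 1; rewrite addn1 mulr1 => E.
have /(congr1 (fun i => i%:R : R)) := lucasD_fib n.
have /(congr1 (fun i => i%:R : R)) := lucasD_5fib n.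
rewrite !(natrD _ (lucas n)) !natrM => E5 E1.
have -> : 4 * (-1) ^+ n = 2 * (2 * (-1) ^+ n) :> R by ring.
have -> : 2 * (2 * (-1) ^+ n)
    = 2 * (fib n.+1)%:R * (lucas n)%:R - (fib n)%:R * (2 * (lucas n.+1)%:R) :> R.
  by rewrite -E; ring.
rewrite -E1 -E5; ring.
Qed.

(** A difference of squares: one factor is given by [fib_lucasB], the other is [2 F_(2a+b)] by
    [fib_lucasD] at [a] and [a + b]. *)
Lemma lucas_fib_sqrB (R : comPzRingType) a b :
  (lucas a)%:R ^+ 2 * (fib (a + b))%:R ^+ 2
    - (fib a)%:R ^+ 2 * (lucas (a + b))%:R ^+ 2
  = 4 * (-1) ^+ a * (fib b)%:R * (fib (2 * a + b))%:R :> R.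
Proof.
have /(congr1 (fun i => i%:R : R)) := fib_lucasD a (a + b).
rewrite addnA addnn -mul2n (natrD _ (fib a * _)) !natrM => ES.
have -> : 4 * (-1) ^+ a * (fib b)%:R * (fib (2 * a + b))%:R
  = (2 * (-1) ^+ a * (fib b)%:R) * (2 * (fib (2 * a + b))%:R) :> R by ring.
rewrite -ES -fib_lucasB; ring.
Qed.

Lemma fibr_neq0 (R : numDomainType) n : (0 < n)%N -> (fib n)%:R != 0 :> R.
Proof. by move=> n0; rewrite pnatr_eq0 -lt0n fib_gt0. Qed.

Lemma cvg_lucas_fib_ratio (R : realType) :
  (fun i => (lucas i)%:R ^+ 2 / (fib i)%:R ^+ 2 : R) @ \oo --> (5 : R).
Proof.
rewrite -[5 : R]addr0.
(* Two shifts in all: they avoid the division by [F_0 = 0], preserve the sign [(-1)^i], and allow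
   the harmonic bound through [F_(i+2) >= i + 1]. *)
rewrite -(cvg_shiftS (fun i => (lucas i)%:R ^+ 2 / (fib i)%:R ^+ 2 : R)).
have fibVcvg0 : (fun i => (fib i.+2)%:R^-1 : R) @ \oo --> (0 : R).
  apply: (@squeeze_cvgr _ _ _ _ (fun=> 0) (@harmonic R)).
  - apply: nearW => i; rewrite invr_ge0 ler0n /=.
    by rewrite /harmonic lef_pV2 ?posrE ?ltr0n ?fib_gt0// ler_nat fib_ge_pred.
  - exact: cvg_cst.
  - exact: cvg_harmonic.
rewrite -(cvg_shiftS (fun i => (lucas i.+1)%:R ^+ 2 / (fib i.+1)%:R ^+ 2 : R)).
have -> : (fun i => (lucas i.+2)%:R ^+ 2 / (fib i.+2)%:R ^+ 2 : R) =
    (fun i => 5 + 4 * (-1) ^+ i * (fib i.+2)%:R^-1 * (fib i.+2)%:R^-1).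
  apply/funext => i; rewrite lucas_sqr !exprS !mulN1r opprK.
  by field; exact: fibr_neq0.
apply: cvgD; first exact: cvg_cst.
(* The alternating sign has no limit; absolute values remove it. *)
apply/norm_cvg0P.
have -> : (fun i => `|4 * (-1) ^+ i * (fib i.+2)%:R^-1 * (fib i.+2)%:R^-1 : R|)
    = (fun i => 4 * (fib i.+2)%:R^-1 * (fib i.+2)%:R^-1).
  apply/funext => i; rewrite !normrM normrX normrN1 expr1n mulr1.
  by rewrite !ger0_norm// invr_ge0 ler0n.
have -> : (0 : R) = 4 * 0 * 0 by rewrite mulr0.
by apply: cvgM => //; apply: cvgM => //; exact: cvg_cst.
Qed.

Lemma cvg_prod_seq (R : realType) (m : nat) (u : nat -> R^nat) (l : R) :
  (forall j, u j @ \oo --> l) ->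
  (fun k => \prod_(0 <= j < m) u j k) @ \oo --> l ^+ m.
Proof.
move=> ul; elim: m => [|m IHm].
  rewrite expr0; under eq_fun do rewrite big_nil.
  exact: cvg_cst.
under eq_fun do rewrite big_nat_recr//=.
by rewrite exprSr; exact: cvgM.
Qed.

Lemma cvg_mulnD (n c : nat) : (0 < n)%N -> (fun k => n * k + c)%N @ \oo --> \oo.
Proof.
move=> n0 A [N _ NA]; exists N => // k /= Nk; apply: NA => /=.
by rewrite -(mul1n N) (leq_trans (leq_mul n0 Nk))// leq_addr.
Qed.

(** Let [W k] be the sum of [G] over the [q] indices from [k + 1] on. Moving this window one step
    changes it by [G (k+1+q) - G (k+1)], so the sum telescopes in [W]. *)
Lemma telescope_sum_lag (V : zmodType) (q N : nat) (G : nat -> V) :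
  \sum_(1 <= k < N.+1) (G (k + q)%N - G k)
  = \sum_(0 <= i < q) G (N.+1 + i)%N - \sum_(1 <= i < q.+1) G i.
Proof.
rewrite big_add1/= [X in _ = _ - X]big_add1/=.
rewrite -(telescope_sumr (fun k => \sum_(0 <= i < q) G (k.+1 + i)%N) (leq0n N)).
apply: eq_bigr => k _; rewrite -sumrB -[X in _ - G X]addn0.
rewrite -(telescope_sumr (fun i => G (k.+1 + i)%N) (leq0n q)).
by apply: eq_bigr => i _; rewrite addnS addSn.
Qed.

(** Replacing [k] by [k + q] turns index [j] into [j + 1], so [G k] and [G (k + q)] share the
    factors [1 <= j < m] and differ only in one end factor each, at [j = 0] and [j = m]. *)
Lemma summand_eq_lag_diff (R : numFieldType) (m n q k : nat) :
  (0 < m)%N -> (0 < n)%N -> (0 < q)%N -> (0 < k)%N ->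
  let G k := \prod_(0 <= j < m) ((lucas (n * k + j * n * q))%:R ^+ 2
                                  / (fib (n * k + j * n * q))%:R ^+ 2) : R in
  ((-1) ^+ (n * k - 1)%N * (fib (2 * n * k + m * n * q))%:R
     * \prod_(1 <= j < m) (lucas (n * k + j * n * q))%:R ^+ 2)
    / \prod_(0 <= j < m.+1) (fib (n * k + j * n * q))%:R ^+ 2
  = (G (k + q)%N - G k) / (4 * (fib (m * n * q))%:R).
Proof.
move=> m0 n0 q0 k0 G.
have nk0 : (0 < n * k)%N by rewrite muln_gt0 n0.
have b0 : (fib (m * n * q))%:R != 0 :> R by rewrite fibr_neq0// !muln_gt0 m0 n0.
have a0 : (fib (n * k))%:R != 0 :> R by rewrite fibr_neq0.
have ab0 : (fib (n * k + m * n * q))%:R != 0 :> R.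
  by rewrite fibr_neq0// addn_gt0 nk0.
have := lucas_fib_sqrB R (n * k) (m * n * q).
(* Since [n * k > 0], the truncated subtraction is exact; the sign change reverses the difference of
   squares into the order [G (k + q) - G k]. *)
rewrite mulnA (_ : (-1) ^+ (n * k) = - (-1) ^+ (n * k - 1) :> R); last first.
  by rewrite -[in LHS](subnK nk0) addn1 exprS mulN1r.
case: m m0 @G b0 ab0 => // m _ G b0 ab0 key.
have GE : G k = (lucas (n * k))%:R ^+ 2 / (fib (n * k))%:R ^+ 2 *
    \prod_(1 <= j < m.+1) ((lucas (n * k + j * n * q))%:R ^+ 2
                           / (fib (n * k + j * n * q))%:R ^+ 2).
  by rewrite /G big_ltn// !mul0n addn0.
have GqE : G (k + q)%N =
    \prod_(1 <= j < m.+1) ((lucas (n * k + j * n * q))%:R ^+ 2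
                           / (fib (n * k + j * n * q))%:R ^+ 2)
    * ((lucas (n * k + m.+1 * n * q))%:R ^+ 2
       / (fib (n * k + m.+1 * n * q))%:R ^+ 2).
  rewrite -(big_nat_recr m.+1 1 (fun j => (lucas (n * k + j * n * q))%:R ^+ 2
       / (fib (n * k + j * n * q))%:R ^+ 2))//=.
  rewrite big_add1/=; apply: eq_bigr => j _.
  by have -> : (n * (k + q) + j * n * q = n * k + j.+1 * n * q)%N by lia.
(* The denominator also loses both end factors, so only the shared products [P] and [Q] remain. *)
rewrite GE GqE prodf_div (big_ltn (ltn0Sn m.+1)) !mul0n addn0 (big_nat_recr m.+1)//.
set P := \prod_(1 <= j < m.+1) (fib _)%:R ^+ 2.
set Q := \prod_(1 <= j < m.+1) (lucas _)%:R ^+ 2.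
have P0 : P != 0.
  rewrite /P prodf_seq_neq0; apply/allP => j _ /=.
  by rewrite sqrf_eq0 fibr_neq0// addn_gt0 nk0.
move: key a0 b0 ab0 P0.
move: (fib (2 * n * k + _)) (fib (n * k + _)) (lucas (n * k + _)) => S Fab Lab.
move=> key a0 b0 ab0 P0.
have {key} key : (-1) ^+ (n * k - 1) * S%:R
    = ((fib (n * k))%:R ^+ 2 * Lab%:R ^+ 2
       - (lucas (n * k))%:R ^+ 2 * Fab%:R ^+ 2)
      / (4 * (fib (m.+1 * n * q))%:R) :> R.
  by rewrite -[X in X / _]opprB key; field.
by rewrite key /=; field; rewrite a0 b0 ab0 P0.
Qed.

Theorem theorem2p40 (R : realType) (m n q : nat)
  (m_gt0 : (0 < m)%N) (n_gt0 : (0 < n)%N) (q_gt0 : (0 < q)%N) :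
  (fun N : nat =>
     \sum_(1 <= k < N.+1)
        ((-1) ^+ (n * k - 1)%N * (fib (2 * n * k + m * n * q))%:R
           * \prod_(1 <= j < m) (lucas (n * k + j * n * q))%:R ^+ 2)
        / \prod_(0 <= j < m.+1) (fib (n * k + j * n * q))%:R ^+ 2 : R)
    @ \oo -->
  ((5%:R ^+ m * q%:R) / (4%:R * (fib (m * n * q))%:R)
   - 1 / (4%:R * (fib (m * n * q))%:R)
     * \sum_(1 <= k < q.+1) \prod_(0 <= j < m)
         ((lucas (n * k + j * n * q))%:R ^+ 2
            / (fib (n * k + j * n * q))%:R ^+ 2) : R).
Proof.
pose G k := \prod_(0 <= j < m) ((lucas (n * k + j * n * q))%:R ^+ 2
                                / (fib (n * k + j * n * q))%:R ^+ 2) : R.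
have Gcvg : G @ \oo --> (5 ^+ m : R).
  apply: (@cvg_prod_seq R m (fun j k => (lucas (n * k + j * n * q))%:R ^+ 2
                                / (fib (n * k + j * n * q))%:R ^+ 2)) => j.
  exact: cvg_comp (cvg_mulnD n (j * n * q) n_gt0) (cvg_lucas_fib_ratio R).
set b := 4%:R * _.
(* Writing [q 5^m] as a sum of [q] equal terms lets the limit be taken term by term over the
   window. *)
have -> : 5%:R ^+ m * q%:R / b - 1 / b * \sum_(1 <= k < q.+1) G k
    = (\sum_(0 <= i < q) 5%:R ^+ m - \sum_(1 <= k < q.+1) G k) / b.
  by rewrite sumr_const_nat subn0 mulr_natr mulrBl mul1r [b^-1 * _]mulrC.
under eq_fun => N.
  rewrite (eq_big_nat _ _ (F2 := fun k => (G (k + q)%N - G k) / b)); last first.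
    by move=> k /andP[k0 _]; exact: summand_eq_lag_diff.
  rewrite -mulr_suml telescope_sum_lag.
  over.
apply: cvgM; last exact: cvg_cst.
apply: cvgB; last exact: cvg_cst.
apply: cvg_big => [|i _]; first exact: add_continuous.
(* Each window term is [G] shifted by the fixed amount [i + 1]. *)
under eq_fun do rewrite addSnnS.
by move: Gcvg; rewrite -(cvg_shiftn i.+1 G).
Qed.
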